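(* Let $X=(X,\rho)$ be a compact metric space, and let $T:X\to X$ be a $1$-Lipschitz map, i.e. $\rho(Tx,Ty)\le\rho(x,y)$ for all $x,y\in X$. Let $\mathcal{B}$ denote the Borel $\sigma$-algebra on $X$, and let $\mu$ be a $T$-invariant, ergodic Borel probability measure on $X$. Let $(r_k)_{k=1}^\infty$ be a non-increasing sequence of positive numbers with $\lim_{k\to\infty}r_k=0$, and let $B_k(x)=\{y\in X:\rho(x,y)<r_k\}$. Then the set of $x\in X$ such that $$\frac1{\mu(B_k(x))}\int_{B_k(x)}\frac1k\sum_{i=0}^{k-1}T^i f\,\mathrm{d}\mu\;\xrightarrow{k\to\infty}\;\int f\,\mathrm{d}\mu\quad\text{for all } f\in C(X)$$ is of full $\mu$-measure.
   Context: $T^i f$ denotes $f\circ T^i$. $C(X)$ is the space of complex-valued continuous functions on $X$. For every $x\in\operatorname{supp}(\mu)$, hence for almost every $x$, $\mu(B_k(x))>0$ for all $k$, so the quotients are defined for almost every $x$. *)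

(* Defs.v *)
From HB Require Import structures.
From mathcomp Require Import all_boot all_order all_algebra.
From mathcomp Require Import complex.
From mathcomp Require Import all_classical all_reals all_analysis.

Set Implicit Arguments.
Unset Strict Implicit.
Unset Printing Implicit Defensive.

Import Order.TTheory GRing.Theory Num.Theory.
Import numFieldNormedType.Exports.

Local Open Scope classical_set_scope.
Local Open Scope complex_scope.
Local Open Scope ring_scope.

(* In the library a [measurableType] is pointed whereas a [metricType] is not.
   The point is a typing device only: a space carrying a probability measure
   is nonempty. *)
#[short(type="pmetricType")]
HB.structure Definition PointedMetric (K : numDomainType) :=
  {M of Metric K M & Pointed M}.

Definition invariant_measure (R : realType) (d : measure_display)
    (S : measurableType d) (mu : probability S R) (T : S -> S) : Prop :=
  forall A : set S, measurable A -> mu (T @^-1` A) = mu A.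

Definition ergodic_measure (R : realType) (d : measure_display)
    (S : measurableType d) (mu : probability S R) (T : S -> S) : Prop :=
  forall A : set S, measurable A -> T @^-1` A = A ->
    mu A = 0%E \/ mu A = 1%E.

Definition Cintegral (R : realType) (d : measure_display)
    (S : measurableType d) (mu : probability S R) (D : set S)
    (f : S -> R[i]) : R[i] :=
  (\int[mu]_(x in D) complex.Re (f x)) +i* (\int[mu]_(x in D) complex.Im (f x)).

(* When [mu D = 0] this is [0], as [0^-1 = 0]. *)
Definition Cmean (R : realType) (d : measure_display)
    (S : measurableType d) (mu : probability S R) (D : set S)
    (f : S -> R[i]) : R[i] :=
  ((fine (mu D))^-1)%:C * Cintegral mu D f.

Definition birkhoff_average (R : realType) (S : Type) (T : S -> S)
    (f : S -> R[i]) (k : nat) (x : S) : R[i] :=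
  k%:R^-1 * \sum_(i < k) f (iter i T x).

(* Main.v *)
(* By compactness, f is uniformly continuous, and T being 1-Lipschitz the
   Birkhoff averages A_k f are equicontinuous; so the mean of A_k f over B_k(x)
   has the same limit as A_k f(x), so it suffices to show A_k f(x) --> \int f for
   every x in supp(mu).  For such x and e > 0, the set of y with
   limsup_k |A_k f(y) - A_k f(x)| <= e is exactly T-invariant and contains a
   ball around x, which has positive measure: by ergodicity it has measure 1.
   Hence A_k f - A_k f(x) --> 0 almost everywhere, and dominated convergence
   with \int A_k f = \int f gives the claim. *)
Require Import Defs.
From mathcomp Require Import all_boot all_order all_algebra.
From mathcomp Require Import complex.
From mathcomp Require Import all_classical all_reals all_analysis.
From mathcomp Require Import finmap measurable_realfun lra.

Import Order.TTheory GRing.Theory Num.Theory.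
Import numFieldNormedType.Exports.

Local Open Scope classical_set_scope.
Local Open Scope complex_scope.
Local Open Scope ring_scope.

(** * Borel measurability of open sets, continuous functions and balls *)

Lemma open_borel {R : realType} (X : pmetricType R) (U : set X) :
  open U -> measurable (U : set (g_sigma_algebraType (@open X))).
Proof. by move=> oU; exact: sub_sigma_algebra. Qed.

Lemma continuous_borel_fun {R : realType} (X : pmetricType R) (f : X -> R) :
  continuous f ->
  measurable_fun setT (f : g_sigma_algebraType (@open X) -> R).
Proof.
move=> /continuousP cf; apply: (measurability _ (RGenOpens.measurableE R)).
move=> _ [_ [a [b ->] <-]]; rewrite setTI.
by apply: open_borel; exact/cf/interval_open.
Qed.

Lemma continuous_borel_map {R : realType} (X : pmetricType R) (T : X -> X) :
  continuous T ->
  measurable_fun setT (T : g_sigma_algebraType (@open X) ->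
                           g_sigma_algebraType (@open X)).
Proof.
move=> /continuousP cT.
apply: (@measurability _ _ (g_sigma_algebraType (@open X))
  (g_sigma_algebraType (@open X)) setT T (@open X) erefl).
by move=> _ [A oA <-]; rewrite setTI; apply: open_borel; exact: cT.
Qed.

Lemma open_mball {R : realType} (X : pmetricType R) (x : X) (e : R) :
  open [set y : X | mdist x y < e].
Proof.
rewrite openE => y /= xy; apply/metricType_numDomainType.nbhs_mdistP => /=.
exists (e - mdist x y) => /=; first by rewrite subr_gt0.
by move=> z /= yz; apply: (le_lt_trans (metric_triangle x y z)); lra.
Qed.

Lemma measurable_mball {R : realType} (X : pmetricType R) (x : X) (e : R) :
  measurable ([set y : X | mdist x y < e] :
    set (g_sigma_algebraType (@open X))).
Proof. by apply: open_borel; exact: open_mball. Qed.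

(** * Uniform continuity and boundedness from compactness *)

Lemma compact_uniform_continuity {R : realType} (X : pmetricType R)
    (f : X -> R) :
  compact [set: X] -> continuous f -> forall e : R, 0 < e ->
  exists2 d : R, 0 < d & forall x y : X, mdist x y < d -> `|f x - f y| < e.
Proof.
move=> /compact_near_coveringP cX cf e e0.
have h : \forall d \near (0:R)^'+, [set: X] `<=`
   (fun x => forall y, mdist x y < d -> `|f x - f y| < e).
  apply: cX => x _.
  have /cvgrPdist_lt/(_ (e/2)) := cf x.
  rewrite divr_gt0// => /(_ isT)
    /metricType_numDomainType.nbhs_mdistP[/= a a0 fa].
  (* The radius [a] at [x] is halved: if [y] is within [a / 2] of [x] and [z] within [d < a / 2] of
     [y], then both lie in the [a]-ball of [x], where [f] varies by less than [e / 2] from [f x]. *)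
  exists ([set y | mdist x y < a / 2], [set d | d < a / 2]) => /=.
    split.
      apply/metricType_numDomainType.nbhs_mdistP; exists (a / 2) => //=; lra.
    by apply: nbhs_right_lt; lra.
  move=> [y d]/= [xy da] z yz.
  have h1 : `|f x - f y| < e / 2 by apply: fa => /=; lra.
  have h2 : `|f x - f z| < e / 2.
    by apply: fa => /=; apply: (le_lt_trans (metric_triangle x y z)); lra.
  rewrite (_ : f y - f z = (f x - f z) - (f x - f y)); last by lra.
  by apply: (le_lt_trans (ler_normB _ _)); lra.
have [d [dP d0]] : exists d : R, [set: X] `<=`
   (fun x => forall y, mdist x y < d -> `|f x - f y| < e) /\ 0 < d.
  near (0:R)^'+ => d; exists d; split; first by near: d.
  by near: d; exact: nbhs_right_gt.
by exists d => // x y; exact: dP.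
Unshelve. all: by end_near. Qed.

Lemma compact_continuous_bounded {R : realType} (X : pmetricType R)
    (f : X -> R) :
  compact [set: X] -> continuous f ->
  exists2 M : R, 0 < M & forall x : X, `|f x| <= M.
Proof.
move=> cX cf.
have : compact (f @` [set: X]).
  by apply: continuous_compact => //; exact: continuous_subspaceT.
move/compact_bounded => /pinfty_ex_gt0[M M0 fM].
by exists M => // x; apply: fM; exists x.
Qed.

(** * Balls around almost every point have positive measure *)

Lemma negligible_bigcup_fset {d} {S : measurableType d} {R : realType}
    (mu : {measure set S -> \bar R}) (I : choiceType) (D : {fset I})
    (F : I -> set S) :
  (forall i, mu.-negligible (F i)) ->
  mu.-negligible (\bigcup_(i in [set` D]) F i).
Proof.
move=> F0; rewrite bigcup_fset; elim/big_ind : _ => //.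
- exact: negligible_set0.
- by move=> A B; exact: negligibleU.
Qed.

(** Finitely many balls of radius [e / 2] cover the space. A point whose [e]-ball is null lies in
    one of them; that ball is inside the [e]-ball, hence null too. The exceptional points are thus
    covered by finitely many null balls. *)
Lemma mball_gt0_ae {R : realType} (X : pmetricType R)
    (mu : probability (g_sigma_algebraType (@open X)) R) (e : R) :
  compact [set: X] -> 0 < e ->
  {ae mu, forall x : X, (0 < mu [set y : X | (mdist x y < e)%R])%E}.
Proof.
rewrite compact_cover => cX e0.
have [||D _ cD] := cX X setT (fun c => [set y : X | mdist c y < e / 2]).
- by move=> c _; exact: open_mball.
- by move=> x _; exists x => //=; rewrite mdistxx; lra.
(* [F c] is the covering ball around [c] if that ball is null, and empty otherwise. *)
pose F c := [set y : X | mu [set y : X | (mdist c y < e / 2)%R] = 0%E /\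
  mdist c y < e / 2].
apply: (@negligibleS _ _ _ mu (\bigcup_(c in [set` D]) F c)); last first.
  apply: negligible_bigcup_fset => c.
  have [c0|c0] := pselect (mu [set y : X | (mdist c y < e / 2)%R] = 0%E).
    apply: (@negligibleS _ _ _ mu [set y : X | mdist c y < e / 2]).
      by move=> y [].
    by apply/negligibleP => //; exact: measurable_mball.
  have -> : F c = set0 by apply/seteqP; split=> // y [].
  exact: negligible_set0.
move=> x /= /negP; rewrite -leNgt => x0.
have [c /= cD' cx] := cD x I.
exists c => //; split => //; apply/eqP; rewrite -measure_le0.
apply: le_trans x0; apply: le_measure;
  [by apply/mem_set; exact: measurable_mball..|].
move=> y /= cy; apply: (le_lt_trans (metric_triangle x c y)).
by rewrite metric_sym; lra.
Qed.

Lemma exists_invn_lt {R : realType} (e : R) :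
  0 < e -> exists n : nat, n.+1%:R^-1 < e.
Proof.
move=> e0; have /cvgrPdist_lt/(_ _ e0)[n _ /(_ n (leqnn _))] := @cvg_harmonic R.
by rewrite sub0r normrN ger0_norm//= ?invr_ge0//; exists n.
Qed.

(** * Birkhoff averages of real-valued functions *)

Definition real_average {R : realType} {S : Type} (T : S -> S)
    (f : S -> R) (k : nat) (x : S) : R :=
  k%:R^-1 * \sum_(i < k) f (iter i T x).

Lemma le_norm_mean (R : realType) (k : nat) (u : nat -> R) (M : R) :
  0 <= M -> (forall i, `|u i| <= M) -> `|k%:R^-1 * \sum_(i < k) u i| <= M.
Proof.
move=> M0 uM; rewrite normrM normfV normr_nat.
(* For [k = 0] the mean is [0], since [0^-1 = 0]; the bound is then [0 <= M]. *)
have [->|k0] := eqVneq k 0%N; first by rewrite invr0 mul0r.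
rewrite ler_pdivrMl ?ltr0n ?lt0n//; apply: (le_trans (ler_norm_sum _ _ _)).
rewrite -[k in k%:R]card_ord mulr_natl -sumr_const.
by apply: ler_sum => i _; exact: uM.
Qed.

Lemma iter_lipschitz1 {R : realType} (X : metricType R) (T : X -> X) :
  (forall x y : X, mdist (T x) (T y) <= mdist x y) ->
  forall i (x y : X), mdist (iter i T x) (iter i T y) <= mdist x y.
Proof.
by move=> T1 i x y; elim: i => //= i; exact: le_trans.
Qed.

Lemma lipschitz1_continuous {R : realType} (X : metricType R) (T : X -> X) :
  (forall x y : X, mdist (T x) (T y) <= mdist x y) -> continuous T.
Proof.
move=> T1 x; apply/metricType_numDomainType.cvgrPdist_lt => e e0.
apply/metricType_numDomainType.nbhs_mdistP; exists e => //= y /=.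
exact: le_lt_trans.
Qed.

(** The iterates of [T] do not increase distances, so each term of the average is controlled by the
    same [d], whatever [k] is. *)
Lemma real_average_equicontinuous {R : realType} (X : metricType R)
    (T : X -> X) (f : X -> R) (d e : R) :
  (forall x y : X, mdist (T x) (T y) <= mdist x y) -> 0 < e ->
  (forall x y : X, mdist x y < d -> `|f x - f y| < e) ->
  forall k (x y : X), mdist x y < d ->
    `|real_average T f k x - real_average T f k y| <= e.
Proof.
move=> T1 e0 fe k x y xy; rewrite /real_average -mulrBr -sumrB.
apply: (@le_norm_mean R k (fun i => f (iter i T x) - f (iter i T y))) => [|i].
  exact: ltW.
by apply/ltW/fe/le_lt_trans/xy/iter_lipschitz1.
Qed.

(** The difference telescopes to [k%:R^-1 * (f (iter k T x) - f x)], which is at most [2M / k] in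
    absolute value. *)
Lemma real_average_shift {R : realType} (S : Type) (T : S -> S) (f : S -> R)
    (M : R) (x : S) : (forall x, `|f x| <= M) ->
  real_average T f k (T x) - real_average T f k x @[k --> \oo] --> 0.
Proof.
move=> fM.
have E k : real_average T f k (T x) - real_average T f k x =
    k%:R^-1 * (f (iter k T x) - f x).
  rewrite /real_average -mulrBr -sumrB; congr (_ * _).
  under eq_bigr do rewrite -iterSr.
  by rewrite -(telescope_sumr (fun i => f (iter i T x)) (leq0n k)) big_mkord.
have bd k : `|real_average T f k (T x) - real_average T f k x| <=
    k%:R^-1 * (M *+ 2).
  rewrite E normrM ger0_norm// ler_wpM2l// mulr2n.
  by apply: (le_trans (ler_normB _ _)); exact: lerD.
apply: norm_cvg0; apply: (@squeeze_cvgr _ _ _ _ (fun=> 0)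
  (fun k : nat => k%:R^-1 * (M *+ 2))).
- by apply: nearW => k; rewrite bd normr_ge0.
- exact: cvg_cst.
rewrite -[X in _ --> X](mul0r (M *+ 2)); apply: cvgMl.
by rewrite -cvg_shiftS; exact: cvg_harmonic.
Qed.

Lemma iter_continuous {S : topologicalType} (T : S -> S) (i : nat) :
  continuous T -> continuous (iter i T).
Proof.
move=> cT; elim: i => [|i IH] x /=; first exact: cvg_id.
exact: (continuous_comp (IH x) (cT _)).
Qed.

Lemma continuous_sum_ord {R : realType} {S : topologicalType}
    (g : nat -> S -> R) (n : nat) :
  (forall i, continuous (g i)) -> continuous (fun x => \sum_(i < n) g i x).
Proof.
move=> cg; elim: n => [|n IH] x.
  by under [X in continuous_at _ X]eq_fun do rewrite big_ord0; exact: cvg_cst.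
under [X in continuous_at _ X]eq_fun do rewrite big_ord_recr/=.
by apply: cvgD; [exact: IH|exact: cg].
Qed.

Lemma real_average_continuous {R : realType} {S : topologicalType}
    (T : S -> S) (f : S -> R) (k : nat) :
  continuous T -> continuous f -> continuous (real_average T f k).
Proof.
move=> cT cf x; apply: cvgM; first exact: cvg_cst.
apply: (@continuous_sum_ord _ _ (fun i => f \o iter i T)) => i y.
exact: (continuous_comp (iter_continuous T i cT y) (cf _)).
Qed.

(** * Integrals of Birkhoff averages under an invariant measure *)

Lemma bounded_borel_integrable {R : realType} {X : pmetricType R}
    (mu : probability (g_sigma_algebraType (@open X)) R) (f : X -> R) (M : R)
    (D : set (g_sigma_algebraType (@open X))) :
  measurable D -> continuous f -> (forall x, `|f x| <= M) ->
  mu.-integrable D (EFin \o f).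
Proof.
move=> mD cf fM; apply: measurable_bounded_integrable => //.
- exact: le_lt_trans (probability_le1 _ _) (ltry _).
- by apply: measurable_funTS; exact: continuous_borel_fun.
- exists M; split; first exact: num_real.
  by move=> N MN x _; exact: le_trans (ltW MN).
Qed.

(** By induction, one application of [T] is peeled off on the inside: a change of variables turns it
    into integration against the pushforward of [mu], which invariance identifies with [mu]. *)
Lemma Rintegral_iter {R : realType} {X : pmetricType R}
    (mu : probability (g_sigma_algebraType (@open X)) R) (T : X -> X)
    (f : X -> R) (M : R) (i : nat) :
  invariant_measure mu T -> continuous T -> continuous f ->
  (forall x, `|f x| <= M) ->
  \int[mu]_x f (iter i T x) = \int[mu]_x f x.
Proof.
move=> muT cT cf fM; elim: i => // i <-.
have cg : continuous (f \o iter i T).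
  by move=> x; exact: (continuous_comp (iter_continuous T i cT x) (cf _)).
rewrite /Rintegral; congr fine.
under eq_integral do rewrite iterSr.
have mT := continuous_borel_map X T cT.
have := @integral_pushforward _ _ _ _ R _ mT mu setT
  (EFin \o (f \o iter i T)) _ _ measurableT.
rewrite preimage_setT => <- //.
- by apply: eq_measure_integral => A mA _; rewrite /pushforward; exact: muT.
- by apply/measurable_EFinP; exact: continuous_borel_fun.
- apply: (@bounded_borel_integrable _ _ mu (f \o iter i T \o T) M) => [//||x].
    by move=> x; exact: (continuous_comp (cT x) (cg _)).
  exact: fM.
Qed.

Lemma Rintegral_real_average {R : realType} {X : pmetricType R}
    (mu : probability (g_sigma_algebraType (@open X)) R) (T : X -> X)
    (f : X -> R) (M : R) (k : nat) :
  invariant_measure mu T -> continuous T -> continuous f ->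
  (forall x, `|f x| <= M) -> (0 < k)%N ->
  \int[mu]_x real_average T f k x = \int[mu]_x f x.
Proof.
move=> muT cT cf fM k0.
have ifi i : mu.-integrable setT (EFin \o (fun x => f (iter i T x))).
  apply: (@bounded_borel_integrable _ _ mu _ M) => // x.
  exact: (continuous_comp (iter_continuous T i cT x) (cf _)).
have isum n : mu.-integrable setT
    (EFin \o (fun x => \sum_(i < n) f (iter i T x))).
  apply: (@bounded_borel_integrable _ _ mu _ (\sum_(i < n) M)) => // x.
    apply: (@continuous_sum_ord _ _ (fun i => f \o iter i T)) => i y.
    exact: (continuous_comp (iter_continuous T i cT y) (cf _)).
  by apply: (le_trans (ler_norm_sum _ _ _)); exact: ler_sum.
rewrite /real_average RintegralZl//.
have -> n : \int[mu]_x (\sum_(i < n) f (iter i T x)) = n%:R * \int[mu]_x f x.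
  elim: n => [|n IH].
    under eq_Rintegral do rewrite big_ord0.
    by rewrite Rintegral_cst// !mul0r.
  under eq_Rintegral do rewrite big_ord_recr/=.
  rewrite (RintegralD _ (isum n) (ifi n))// -natr1 mulrDl mul1r.
  by congr (_ + _); [exact: IH|exact: Rintegral_iter muT cT cf fM].
by rewrite mulrA mulVf ?mul1r// pnatr_eq0 -lt0n.
Qed.

(** * Convergence of the averages at points of the support *)

(* [average_close T f x0 e] is the set of y such that
   limsup_k |A_k f(y) - A_k f(x0)| <= e. *)
Definition average_close {R : realType} {X : Type} (T : X -> X) (f : X -> R)
    (x0 : X) (e : R) : set X :=
  [set y | forall j : nat, \forall k \near \oo,
     `|real_average T f k y - real_average T f k x0| <= e + j.+1%:R^-1].

Lemma measurable_average_close {R : realType} {X : pmetricType R}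
    (T : X -> X) (f : X -> R) (x0 : X) (e : R) :
  continuous T -> continuous f ->
  measurable (average_close T f x0 e : set (g_sigma_algebraType (@open X))).
Proof.
move=> cT cf.
(* Unfolding the eventual bound gives countable unions and intersections of closed conditions on
   continuous functions; the slacks [j.+1%:R^-1] keep the family countable. *)
have -> : average_close T f x0 e = \bigcap_j \bigcup_N
    \bigcap_(k in [set k | (N <= k)%N]) [set y | `|real_average T f k y -
      real_average T f k x0| <= e + j.+1%:R^-1].
  apply/seteqP; split => y.
    by move=> yH j _; have [N _ NH] := yH j; exists N => // k; exact: NH.
  by move=> yH j; have [N _ NH] := yH j I; exists N => // k; exact: NH.
apply: bigcap_measurable; first by exists 0%N.
move=> j _; apply: bigcup_measurable => N _; apply: bigcap_measurable.
  by exists N => /=.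
move=> k _; set a := e + _.
have : measurable_fun setT (fun y : g_sigma_algebraType (@open X) =>
    `|real_average T f k y - real_average T f k x0|).
  apply: measurableT_comp => //; apply: measurable_funB => //.
  by apply: continuous_borel_fun; exact: real_average_continuous.
move=> /(_ measurableT `]-oo, a]%classic (measurable_itv _)).
by rewrite setTI set_itvNyc.
Qed.

(** Invariance holds exactly, not just up to a null set, as [ergodic_measure] demands. Passing from
    [y] to [T y] changes the averages by a null sequence, which the slack in the definition
    absorbs. *)
Lemma average_close_invariant {R : realType} {X : Type} (T : X -> X)
    (f : X -> R) (M : R) (x0 : X) (e : R) :
  (forall x, `|f x| <= M) ->
  T @^-1` average_close T f x0 e = average_close T f x0 e.
Proof.
move=> fM.
have tr y z : real_average T f k y - real_average T f k z @[k --> \oo] --> 0 ->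
    average_close T f x0 e z -> average_close T f x0 e y.
  move=> yz zH j.
  (* Half of the slack pays for the smaller slack [m.+1%:R^-1] at [z], the other half for the
     distance between the averages at [y] and [z]. *)
  have j0 : 0 < j.+1%:R^-1 / 2 :> R by rewrite divr_gt0.
  have [m mj] := exists_invn_lt _ j0.
  have /cvgrPdist_lt/(_ _ j0) := yz.
  apply: filterS2 (zH m) => k kz; rewrite sub0r normrN => kyz.
  have -> : real_average T f k y - real_average T f k x0 =
    (real_average T f k y - real_average T f k z) +
    (real_average T f k z - real_average T f k x0) by rewrite subrKA.
  apply: (le_trans (ler_normD _ _)); rewrite addrC (splitr j.+1%:R^-1) addrA.
  by rewrite lerD ?(ltW kyz)// (le_trans kz)// lerD2l ltW.
apply/seteqP; split => y /=; apply: tr.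
  apply: norm_cvg0; under eq_fun do rewrite distrC.
  rewrite -(normr0 R); apply: cvg_norm.
  exact: (@real_average_shift _ _ T f M y fM).
exact: (@real_average_shift _ _ T f M y fM).
Qed.

Lemma ae_average_close {R : realType} {X : pmetricType R}
    (mu : probability (g_sigma_algebraType (@open X)) R) (T : X -> X)
    (f : X -> R) (x0 : X) (e : R) :
  compact [set: X] ->
  (forall x y : X, mdist (T x) (T y) <= mdist x y) ->
  ergodic_measure mu T -> continuous f ->
  (forall d, 0 < d -> (0 < mu [set y : X | (mdist x0 y < d)%R])%E) ->
  0 < e -> {ae mu, forall y, average_close T f x0 e y}.
Proof.
move=> cX T1 ergT cf x0supp e0.
have cT := lipschitz1_continuous _ T T1.
have [M M0 fM] := compact_continuous_bounded X f cX cf.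
have mH := measurable_average_close T f x0 e cT cf.
have HT := average_close_invariant T f M x0 e fM.
suff H1 : mu (average_close T f x0 e) = 1%E.
  apply/negligibleP; first exact: measurableC.
  by apply: (etrans (probability_setC _ mH)); rewrite H1 subee.
have [H0|//] := ergT _ mH HT.
(* Measure zero is excluded: by equicontinuity the set contains the [d]-ball around [x0], which has
   positive measure. *)
have [d d0 fd] := compact_uniform_continuity X f cX cf e e0.
have := x0supp d d0; rewrite ltNge => /negP[]; rewrite -H0.
apply: le_measure; [apply/mem_set; exact: measurable_mball|exact/mem_set|].
move=> y /= x0y j; apply: nearW => k.
have := real_average_equicontinuous _ T f d e T1 e0 fd k _ _ x0y.
rewrite distrC => /le_trans; apply.
by rewrite lerDl invr_ge0.
Qed.

Lemma real_average_cvg {R : realType} {X : pmetricType R}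
    (mu : probability (g_sigma_algebraType (@open X)) R) (T : X -> X)
    (f : X -> R) (x0 : X) :
  compact [set: X] ->
  (forall x y : X, mdist (T x) (T y) <= mdist x y) ->
  invariant_measure mu T -> ergodic_measure mu T -> continuous f ->
  (forall d, 0 < d -> (0 < mu [set y : X | (mdist x0 y < d)%R])%E) ->
  real_average T f k x0 @[k --> \oo] --> \int[mu]_x f x.
Proof.
move=> cX T1 muT ergT cf x0supp.
have cT := lipschitz1_continuous _ T T1.
have [M M0 fM] := compact_continuous_bounded X f cX cf.
have AM k x : `|real_average T f k x| <= M.
  by apply: (le_norm_mean _ k (fun i => f (iter i T x))) => //; exact: ltW.
have cA k := real_average_continuous T f k cT cf.
have iA k : mu.-integrable setT (EFin \o real_average T f k).
  exact: (@bounded_borel_integrable _ _ mu _ M).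
have ic (c : R) : mu.-integrable setT (EFin \o (fun=> c)).
  apply: (@bounded_borel_integrable _ _ mu _ `|c|) => // x.
  exact: cvg_cst.
have aeF : Filter (nbhs (almost_everywhere mu)).
  exact: (ae_filter_ringOfSetsType (mu : {measure set _ -> \bar R})).
have aeD : {ae mu, forall y,
    real_average T f k y - real_average T f k x0 @[k --> \oo] --> 0}.
  have : {ae mu, forall y, forall n, average_close T f x0 n.+1%:R^-1 y}.
    apply: ae_foralln => n.
    by apply: (ae_average_close mu) => //; rewrite invr_gt0.
  apply: filterS => y yH; apply/cvgrPdist_lt => e e0.
  have e20 : 0 < e / 2 by rewrite divr_gt0.
  have [m me] := exists_invn_lt _ e20.
  (* The index [m] serves twice, as the level [m.+1%:R^-1] of the set and as its slack; each is
     below [e / 2]. *)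
  by have := yH m m; apply: filterS => k; rewrite sub0r normrN => /le_lt_trans;
    apply; rewrite (splitr e) ltrD.
(* Both averages are bounded by [M], so the constant [2M] dominates their difference. *)
have [|||||_ _] := @dominated_convergence _ _ R mu setT measurableT
   (fun k y => (real_average T f k y - real_average T f k x0)%:E)
   (cst 0%E) (cst (M *+ 2)%:E).
- move=> k; apply/measurable_EFinP/measurable_funB => //.
  exact: continuous_borel_fun.
- exact: measurable_cst.
- apply: filterS aeD => y yA _; apply: cvg_EFin; [exact: nearW|exact: yA].
- exact: ic.
- apply: nearW => y k _ /=; rewrite lee_fin mulr2n.
  by apply: (le_trans (ler_normB _ _)); exact: lerD.
rewrite integral0 => /fine_cvg/= D0.
(* The index [0] is left out: the average of order [0] vanishes identically, so its integral need
   not be that of [f]. *)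
have E k : (0 < k)%N ->
    fine (\int[mu]_y (real_average T f k y - real_average T f k x0)%:E)%E =
    \int[mu]_x f x - real_average T f k x0.
  move=> k0.
  apply: (etrans (RintegralB measurableT (iA k) (ic (real_average T f k x0)))).
  congr (_ - _); first exact: (Rintegral_real_average mu T f M).
  apply: (etrans (Rintegral_cst mu measurableT (real_average T f k x0))).
  by apply: (etrans (congr1 (fun t => _ * fine t) (probability_setT mu)));
    rewrite mulr1.
apply/cvgrPdist_lt => e e0.
have /cvgrPdist_lt/(_ _ e0) := D0.
apply: filterS2 (nbhs_infty_gt 0) => k k0.
by rewrite -(E _ k0) sub0r normrN.
Qed.

(** * Means over shrinking balls *)

(** Integrating [c - e <= g <= c + e] over [D] and dividing by the positive finite number [mu D]
    gives both bounds. *)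
Lemma mean_near {d} {S : measurableType d} {R : realType} (mu : probability S R)
    (D : set S) (g : S -> R) (c e : R) :
  measurable D -> (0 < mu D)%E -> mu.-integrable D (EFin \o g) ->
  (forall y, D y -> `|g y - c| <= e) ->
  `|(fine (mu D))^-1 * \int[mu]_(y in D) g y - c| <= e.
Proof.
move=> mD D0 ig gc.
have Dfin : (mu D < +oo)%E.
  exact: le_lt_trans (probability_le1 _ mD) (ltry _).
have m0 : 0 < fine (mu D) by rewrite fine_gt0// D0.
have ic a : mu.-integrable D (EFin \o fun=> a).
  by apply: measurable_bounded_integrable => //; exact: bounded_cst.
have hl : (c - e) * fine (mu D) <= \int[mu]_(y in D) g y.
  rewrite -Rintegral_cst//; apply: le_Rintegral => // y Dy.
  by have := gc y Dy; rewrite ler_norml; lra.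
have hr : \int[mu]_(y in D) g y <= (c + e) * fine (mu D).
  rewrite -Rintegral_cst//; apply: le_Rintegral => // y Dy.
  by have := gc y Dy; rewrite ler_norml; lra.
have h1 : (fine (mu D))^-1 * \int[mu]_(y in D) g y <= c + e.
  by rewrite mulrC ler_pdivrMr.
have h2 : c - e <= (fine (mu D))^-1 * \int[mu]_(y in D) g y.
  by rewrite mulrC ler_pdivlMr.
by rewrite ler_norml; lra.
Qed.

(** The error splits in two halves: once [r k < d], equicontinuity puts the mean over the ball
    within [e / 2] of the average at the centre, which is itself eventually within [e / 2] of the
    integral. *)
Lemma mball_mean_cvg {R : realType} {X : pmetricType R}
    (mu : probability (g_sigma_algebraType (@open X)) R) (T : X -> X)
    (f : X -> R) (x : X) (r : nat -> R) :
  compact [set: X] ->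
  (forall x y : X, mdist (T x) (T y) <= mdist x y) ->
  invariant_measure mu T -> ergodic_measure mu T -> continuous f ->
  (forall d, 0 < d -> (0 < mu [set y : X | (mdist x y < d)%R])%E) ->
  (forall k : nat, (0 < k)%N -> 0 < r k) ->
  r k @[k --> \oo] --> (0 : R) ->
  (fine (mu [set y : X | (mdist x y < r k)%R]))^-1 *
    \int[mu]_(y in [set y : X | mdist x y < r k]) real_average T f k y
    @[k --> \oo] --> \int[mu]_y f y.
Proof.
move=> cX T1 muT ergT cf xsupp r0 rcvg.
have cT := lipschitz1_continuous _ T T1.
have [M M0 fM] := compact_continuous_bounded X f cX cf.
have AM k y : `|real_average T f k y| <= M.
  by apply: (le_norm_mean _ k (fun i => f (iter i T y))) => //; exact: ltW.
apply/cvgrPdist_lt => e e0.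
have e20 : 0 < e / 2 by rewrite divr_gt0.
have [d d0 fd] := compact_uniform_continuity X f cX cf _ e20.
have /cvgrPdist_lt/(_ _ e20) :=
  real_average_cvg mu T f x cX T1 muT ergT cf xsupp.
have /cvgrPdist_lt/(_ _ d0) := rcvg.
apply: filterS3 (nbhs_infty_gt 0) => k k0 rk Ak.
have near_mean : `|(fine (mu [set y : X | (mdist x y < r k)%R]))^-1 *
    \int[mu]_(y in [set y : X | mdist x y < r k]) real_average T f k y -
    real_average T f k x| <= e / 2.
  apply: mean_near; [exact: measurable_mball|exact/xsupp/r0| |].
    apply: (@bounded_borel_integrable _ _ mu _ M);
      [exact: measurable_mball| |exact: AM].
    exact: real_average_continuous.
  move=> y /= xy; rewrite distrC.
  apply: (real_average_equicontinuous _ T f d) => //.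
  apply: (lt_trans xy); apply: le_lt_trans rk.
  by rewrite sub0r normrN ler_norm.
rewrite (splitr e) distrC -(subrKA (real_average T f k x)).
by apply: (le_lt_trans (ler_normD _ _)); apply: ler_ltD => //; rewrite distrC.
Qed.

(** * Passage from real to complex values *)

Lemma normc_ge_Im {R : rcfType} (z : R[i]) : `|complex.Im z|%:C <= `|z|.
Proof.
(* Multiplication by the imaginary unit preserves the modulus and turns the imaginary part, up to
   sign, into the real part. *)
have := normc_ge_Re (z * 'i%C); rewrite complex.ReiNIm normrN normrM.
by rewrite complexiE normCi mulr1.
Qed.

Lemma normc_le_ReIm {R : rcfType} (z : R[i]) :
  `|z| <= (`|complex.Re z| + `|complex.Im z|)%:C.
Proof.
have nR (a : R) : `|a%:C| = `|a|%:C :> R[i].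
  by rewrite normc_def /= expr0n addr0 sqrtr_sqr.
rewrite {1}(complexE z) rmorphD/= -!nR; apply: (le_trans (ler_normD _ _)).
by rewrite normrM complexiE normCi mul1r.
Qed.

Lemma cvg_complexP {R : realType} {I : Type} (F : set_system I) (FF : Filter F)
    (u : I -> R[i]) (l : R[i]) :
  (u x : R[i]^o) @[x --> F] --> (l : R[i]^o) <->
  (complex.Re (u x) @[x --> F] --> complex.Re l) /\
  (complex.Im (u x) @[x --> F] --> complex.Im l).
Proof.
split=> [ul|[ure uim]].
  split; apply/cvgrPdist_lt => e e0;
    have eC : 0 < (e%:C : R[i]) by rewrite ltcR.
  - have /cvgrPdist_lt/(_ _ eC) := ul; apply: filterS => x.
    by rewrite -ltcR; apply: le_lt_trans;
      have := normc_ge_Re (l - u x); rewrite raddfB.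
  - have /cvgrPdist_lt/(_ _ eC) := ul; apply: filterS => x.
    by rewrite -ltcR; apply: le_lt_trans;
      have := normc_ge_Im (l - u x); rewrite raddfB.
apply/cvgrPdist_lt => e e0.
(* Here [e] is a complex number; being positive in the partial order of [R[i]], it is real. *)
have eE : e = (complex.Re e)%:C by rewrite RRe_real// gtr0_real.
have e20 : 0 < complex.Re e / 2.
  by move: e0; rewrite eE ltcR => ?; rewrite divr_gt0.
have /cvgrPdist_lt/(_ _ e20) := ure.
have /cvgrPdist_lt/(_ _ e20) := uim.
apply: filterS2 => x xim xre; rewrite eE.
apply: (le_lt_trans (normc_le_ReIm _)).
rewrite ltcR !raddfB (splitr (complex.Re e)).
exact: ltrD.
Qed.

Lemma Re_birkhoff_average {R : realType} {S : Type} (T : S -> S) (f : S -> R[i])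
    (k : nat) (x : S) :
  complex.Re (birkhoff_average T f k x) =
  real_average T (fun y => complex.Re (f y)) k x.
Proof.
(* The scalar is recognised as the image of a real number, so that it multiplies each part
   separately. *)
rewrite /birkhoff_average /real_average -(rmorph_nat (real_complex R)) -fmorphV.
have -> : \sum_(i < k) complex.Re (f (iter i T x)) =
    complex.Re (\sum_(i < k) f (iter i T x)).
  by elim/big_rec2 : _ => // i z _ _ ->; case: (f _) z => [? ?] [? ?].
by case: (\sum_(i < k) f (iter i T x)) => a b /=; rewrite mul0r subr0.
Qed.

Lemma Im_birkhoff_average {R : realType} {S : Type} (T : S -> S) (f : S -> R[i])
    (k : nat) (x : S) :
  complex.Im (birkhoff_average T f k x) =
  real_average T (fun y => complex.Im (f y)) k x.
Proof.
rewrite /birkhoff_average /real_average -(rmorph_nat (real_complex R)) -fmorphV.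
have -> : \sum_(i < k) complex.Im (f (iter i T x)) =
    complex.Im (\sum_(i < k) f (iter i T x)).
  by elim/big_rec2 : _ => // i z _ _ ->; case: (f _) z => [? ?] [? ?].
by case: (\sum_(i < k) f (iter i T x)) => a b /=; rewrite mul0r addr0.
Qed.

(* [R[i]^o] is [R[i]] with its norm topology. *)
Theorem theorem2p3 (R : realType) (X : pmetricType R)
    (Xcompact : compact [set: X])
    (T : X -> X)
    (T1lip : forall x y : X, mdist (T x) (T y) <= mdist x y)
    (mu : probability (g_sigma_algebraType (@open X)) R)
    (mu_inv : invariant_measure mu T)
    (mu_erg : ergodic_measure mu T)
    (r : nat -> R)
    (r_gt0 : forall k : nat, (0 < k)%N -> 0 < r k)
    (r_noninc : forall k l : nat, (0 < k)%N -> (k <= l)%N -> r l <= r k)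
    (r_cvg0 : r k @[k --> \oo] --> (0 : R)) :
  let B (k : nat) (x : X) : set X := [set y : X | mdist x y < r k] in
  {ae mu, forall x : X,
    (forall k : nat, (0 < k)%N -> (0 < mu (B k x))%E) /\
    (forall f : X -> R[i]^o, continuous f ->
      (Cmean mu (B k x) (birkhoff_average T f k) : R[i]^o) @[k --> \oo]
        --> (Cintegral mu [set: X] f : R[i]^o))}.
Proof.
move=> B.
have aeF : Filter (nbhs (almost_everywhere mu)).
  exact: (ae_filter_ringOfSetsType (mu : {measure set _ -> \bar R})).
(* The exceptional set is built from countably many radii before any [f] is chosen, so it serves all
   continuous functions at once. *)
have : {ae mu, forall x : X, forall n : nat,
    (0 < mu [set y : X | (mdist x y < n.+1%:R^-1)%R])%E}.
  by apply: ae_foralln => n; apply: mball_gt0_ae => //; rewrite invr_gt0.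
apply: filterS => x xn.
have xsupp d : 0 < d -> (0 < mu [set y : X | (mdist x y < d)%R])%E.
  move=> d0.
  have [m md] := exists_invn_lt _ d0.
  apply: (lt_le_trans (xn m)).
  apply: le_measure; [apply/mem_set; exact: measurable_mball..|].
  by move=> y /= xy; exact: lt_trans md.
split=> [k k0|f cf]; first exact/xsupp/r_gt0.
have cRe : continuous (fun y => complex.Re (f y) : R).
  by move=> y; have /cvg_complexP[] := cf y.
have cIm : continuous (fun y => complex.Im (f y) : R).
  by move=> y; have /cvg_complexP[] := cf y.
have CmeanE k : Cmean mu (B k x) (birkhoff_average T f k) =
    ((fine (mu (B k x)))^-1 *
      \int[mu]_(y in B k x) real_average T (fun y => complex.Re (f y)) k y) +i*
    ((fine (mu (B k x)))^-1 *
      \int[mu]_(y in B k x) real_average T (fun y => complex.Im (f y)) k y).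
  rewrite /Cmean /Cintegral.
  under eq_Rintegral do rewrite Re_birkhoff_average.
  under [X in _ +i* X]eq_Rintegral do rewrite Im_birkhoff_average.
  by apply/eqP; rewrite eq_complex /= !mul0r subr0 addr0 !eqxx.
apply/cvg_complexP; split.
  under eq_fun do rewrite CmeanE.
  exact: mball_mean_cvg.
under eq_fun do rewrite CmeanE.
exact: mball_mean_cvg.
Qed.
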